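(* Let $\mathcal H_1,\mathcal H_2,\mathcal D_S,\mathcal D_2,\mathcal D_{-S},\mathcal D_{-1},\mathcal D_{-2}$ be complex Hilbert spaces and $A,B,C,D_0,D,D^\ddagger$ operators satisfying assumptions (a)--(c) of the context, and let $S$, $\mathcal A_0$ (in $\mathcal H=\mathcal H_1\oplus\mathcal H_2$) and $S_0$ (in $\mathcal H_1$) be as defined in the context. Assume that $S\in\mathcal B(\mathcal D_S,\mathcal D_{-S})$ and $B(\operatorname{dom}D_0)\subset\mathcal D_{-S}$. (i) Let $0\in\rho(D_0)$. If $S^{-1}\in\mathcal B(\mathcal D_{-S},\mathcal D_S)$ (which by the continuity of the embeddings $\mathcal D_S\hookrightarrow\mathcal H_1\hookrightarrow\mathcal D_{-S}$ implies $0\in\rho(S_0)$), then $0\in\rho(\mathcal A_0)$. (ii) Let $\operatorname{dom}S_0$ be dense in $\mathcal D_S$, let $D_0\in\mathcal F_+(\mathcal H_2)$ and $S_0\in\mathcal F_+(\mathcal H_1)$ be such that there exists an extension $S^\ddagger\supset S_0^\#$ with $S^\ddagger\in\mathcal B(\mathcal D_{-S},\mathcal D_S)$. Then $\mathcal A_0\in\mathcal F_+(\mathcal H)$.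
   Context: Notation. $\mathcal B(\mathcal G_1,\mathcal G_2)$ is the space of everywhere defined bounded linear operators between Hilbert spaces; $\mathcal C(\mathcal G)$ is the set of closed (not necessarily densely defined) linear operators in $\mathcal G$; $\rho$ denotes the resolvent set. For a linear operator $T$ in $\mathcal G$, $\operatorname{coker}T:=(\operatorname{ran}T)^\perp$. $\mathcal F_+(\mathcal G)=\{T\in\mathcal C(\mathcal G):\operatorname{ran}T\text{ closed},\ \dim\ker T<\infty\}$. For $T\in\mathcal C(\mathcal G)$ with closed range, the generalised inverse $T^\#\in\mathcal B(\mathcal G)$ is defined by $T^\#x=(T|_{\operatorname{dom}T\cap(\ker T)^\perp})^{-1}x$ for $x\in\operatorname{ran}T$ and $T^\#x=0$ for $x\in\operatorname{coker}T$. For operators, $T_1\subset T_2$ means $T_2$ extends $T_1$. Assumptions. (a) $\mathcal D_S\subset\mathcal H_1\subset\mathcal D_{-S}$ and $\mathcal D_2\subset\mathcal H_2\subset\mathcal D_{-2}$, where all these canonical embeddings are continuous with dense range; moreover $\mathcal D_{-S}\subset\mathcal D_{-1}$ is continuously embedded. (b) $A\in\mathcal B(\mathcal D_S,\mathcal D_{-1})$, $B\in\mathcal B(\mathcal D_2,\mathcal D_{-1})$, $C\in\mathcal B(\mathcal D_S,\mathcal D_{-2})$. (c) $D_0\in\mathcal C(\mathcal H_2)$ has closed range in $\mathcal H_2$, $\operatorname{dom}D_0\subset\mathcal D_2$ is dense in $\mathcal D_2$, and there are extensions $D_0\subset D\in\mathcal B(\mathcal D_2,\mathcal D_{-2})$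 and $D_0^\#\subset D^\ddagger\in\mathcal B(\mathcal D_{-2},\mathcal D_2)$. Definitions. With $\mathcal D:=\mathcal D_S\oplus\mathcal D_2$ and $\mathcal D_-:=\mathcal D_{-1}\oplus\mathcal D_{-2}$, put $$\mathcal A:=\begin{pmatrix}A&B\\C&D\end{pmatrix}\in\mathcal B(\mathcal D,\mathcal D_-),\qquad S:=A-BD^\ddagger C\in\mathcal B(\mathcal D_S,\mathcal D_{-1}).$$ $\mathcal A_0:=\mathcal A|_{\operatorname{dom}\mathcal A_0}$ with $\operatorname{dom}\mathcal A_0:=\{(f,g)\in\mathcal D:\mathcal A(f,g)\in\mathcal H\}$, an operator in $\mathcal H=\mathcal H_1\oplus\mathcal H_2$; $S_0:=S|_{\operatorname{dom}S_0}$ with $\operatorname{dom}S_0:=\{f\in\mathcal D_S:Sf\in\mathcal H_1\}$, an operator in $\mathcal H_1$. The condition $S\in\mathcal B(\mathcal D_S,\mathcal D_{-S})$ means that $S$ maps $\mathcal D_S$ into $\mathcal D_{-S}\subset\mathcal D_{-1}$ and is bounded as such a map. *)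

(* Defs.v *)
From HB Require Import structures.
From mathcomp Require Import all_boot all_order all_algebra.
From mathcomp Require Import sesquilinear complex.
From mathcomp Require Import ring.
From mathcomp Require Import all_classical all_reals all_analysis.

Set Implicit Arguments.
Unset Strict Implicit.
Unset Printing Implicit Defensive.

Import Order.TTheory GRing.Theory Num.Theory.
Import numFieldNormedType.Exports.

Local Open Scope classical_set_scope.
Local Open Scope complex_scope.
Local Open Scope ring_scope.

HB.mixin Record CompleteNormedModule_isHilbert (R : realType) V
    & CompleteNormedModule R[i] V := {
  inner : {dot V for (@Num.conj R[i])} ;
  sqr_norm_inner : forall x : V, `|x| ^+ 2 = inner x x
}.

#[short(type="hilbertType")]
HB.structure Definition Hilbert (R : realType) :=
  {V of CompleteNormedModule R[i] V & CompleteNormedModule_isHilbert R V}.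

Section direct_sum_norm.
Variables (R : realType) (U V : hilbertType R).

(* The library gives U * V the maximum norm; the Hilbert space direct sum is
   this copy of U * V, whose norm comes from an inner product. *)
Definition hsum : Type := (U * V)%type.

HB.instance Definition _ := GRing.Lmodule.copy hsum (U * V)%type.

Definition hsum_norm (x : hsum) : R[i] :=
  sqrtC (`|x.1| ^+ 2 + `|x.2| ^+ 2).

Let sqr_ge0 (x : hsum) : 0 <= `|x.1| ^+ 2 + `|x.2| ^+ 2.
Proof. by rewrite addr_ge0 ?exprn_ge0. Qed.

Lemma hsum_norm_ge0 x : 0 <= hsum_norm x.
Proof. by rewrite sqrtC_ge0. Qed.

Lemma sqr_hsum_norm x : hsum_norm x ^+ 2 = `|x.1| ^+ 2 + `|x.2| ^+ 2.
Proof. exact: sqrtCK. Qed.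

Lemma hsum_normD x y : hsum_norm (x + y) <= hsum_norm x + hsum_norm y.
Proof.
have ge0 := hsum_norm_ge0.
rewrite -(@ler_pXn2r _ 2) ?nnegrE ?addr_ge0// sqrrD !sqr_hsum_norm.
have le1 : `|(x + y).1| ^+ 2 <= (`|x.1| + `|y.1|) ^+ 2.
  by rewrite ler_pXn2r ?nnegrE ?addr_ge0// ler_normD.
have le2 : `|(x + y).2| ^+ 2 <= (`|x.2| + `|y.2|) ^+ 2.
  by rewrite ler_pXn2r ?nnegrE ?addr_ge0// ler_normD.
apply: (le_trans (lerD le1 le2)).
have cs : `|x.1| * `|y.1| + `|x.2| * `|y.2| <= hsum_norm x * hsum_norm y.
  rewrite -(@ler_pXn2r _ 2) ?nnegrE ?addr_ge0 ?mulr_ge0//.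
  rewrite exprMn !sqr_hsum_norm -subr_ge0.
  set a := `|x.1|; set b := `|x.2|; set c := `|y.1|; set d := `|y.2|.
  have -> : (a ^+ 2 + b ^+ 2) * (c ^+ 2 + d ^+ 2) - (a * c + b * d) ^+ 2
            = (a * d - b * c) ^+ 2 by ring.
  by rewrite real_exprn_even_ge0// rpredB// rpredM// normr_real.
rewrite !sqrrD -subr_ge0.
set h := hsum_norm x * _ in cs *.
rewrite (_ : _ - _ =
  (h - (`|x.1| * `|y.1| + `|x.2| * `|y.2|)) *+ 2); last by ring.
by rewrite mulrn_wge0// subr_ge0.
Qed.

Lemma hsum_normZ (a : R[i]) x : hsum_norm (a *: x) = `|a| * hsum_norm x.
Proof.
apply/eqP; rewrite -(@eqrXn2 _ 2) ?mulr_ge0 ?hsum_norm_ge0//.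
by rewrite exprMn !sqr_hsum_norm/= !normrZ !exprMn mulrDr.
Qed.

Lemma hsum_norm0_eq0 x : hsum_norm x = 0 -> x = 0.
Proof.
move=> /(congr1 (fun t => t ^+ 2)); rewrite sqr_hsum_norm expr0n/= => /eqP.
rewrite paddr_eq0 ?exprn_ge0// !expf_eq0/= !normr_eq0 => /andP[/eqP x1 /eqP x2].
by case: x x1 x2 => a b /= -> ->.
Qed.

HB.instance Definition _ := Lmodule_isNormed.Build R[i] hsum
  hsum_normD hsum_normZ hsum_norm0_eq0.


Lemma normE_hsum (x : hsum) : `|x| = hsum_norm x. Proof. by []. Qed.

Lemma norm_fst_hsum (x : hsum) : `|x.1| <= `|x|.
Proof.
rewrite normE_hsum -(@ler_pXn2r _ 2) ?nnegrE ?hsum_norm_ge0//.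
by rewrite sqr_hsum_norm lerDl exprn_ge0.
Qed.

Lemma norm_snd_hsum (x : hsum) : `|x.2| <= `|x|.
Proof.
rewrite normE_hsum -(@ler_pXn2r _ 2) ?nnegrE ?hsum_norm_ge0//.
by rewrite sqr_hsum_norm lerDr exprn_ge0.
Qed.

Lemma norm_hsum_le (x : hsum) : `|x| <= `|x.1| + `|x.2|.
Proof.
rewrite normE_hsum -(@ler_pXn2r _ 2) ?nnegrE ?hsum_norm_ge0 ?addr_ge0//.
by rewrite sqr_hsum_norm sqrrD -addrA lerD2l lerDr mulrn_wge0// mulr_ge0.
Qed.

Lemma hsum_complete (F : set_system hsum) : ProperFilter F -> cauchy F -> cvg F.
Proof.
move=> FF /cauchyP Fc.
have /cauchy_exP/cauchy_cvg/cvg_ex[u Fu] : cauchy_ex ((@fst U V) @ F).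
  move=> e /Fc[x]; rewrite -!ball_normE => Fx; exists x.1; rewrite nbhs_simpl/=.
  by apply: filterS Fx => y; apply: le_lt_trans (norm_fst_hsum (x - y)).
have /cauchy_exP/cauchy_cvg/cvg_ex[v Fv] : cauchy_ex ((@snd U V) @ F).
  move=> e /Fc[x]; rewrite -!ball_normE => Fx; exists x.2; rewrite nbhs_simpl/=.
  by apply: filterS Fx => y; apply: le_lt_trans (norm_snd_hsum (x - y)).
apply/cvg_ex; exists ((u, v) : hsum); apply/fcvgrPdist_lt => e e0.
have {}Fu := (cvgrPdist_lt _ _).1 Fu _ (divr_gt0 e0 (ltr0Sn _ 1)).
have {}Fv := (cvgrPdist_lt _ _).1 Fv _ (divr_gt0 e0 (ltr0Sn _ 1)).
near=> x; rewrite [e]splitr; apply: le_lt_trans (norm_hsum_le _) _.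
by apply: ltrD; near: x; [exact: Fu | exact: Fv].
Unshelve. all: by end_near. Qed.

HB.instance Definition _ := Uniform_isComplete.Build hsum hsum_complete.

Definition hsum_inner (x y : hsum) : R[i] := inner x.1 y.1 + inner x.2 y.2.

Let hsum_inner_bilinear :
  bilinear_for *%R (@Num.conj R[i] \; *%R) hsum_inner.
Proof.
split=> [y a x x'|x a y y'] /=; rewrite /hsum_inner/=.
  by rewrite !linearPl mulrDr addrACA.
by rewrite !linearPr/= mulrDr addrACA.
Qed.

HB.instance Definition _ := bilinear_isBilinear.Build R[i] hsum hsum R[i]
  *%R (@Num.conj R[i] \; *%R) hsum_inner hsum_inner_bilinear.

Let hsum_inner_herm (x y : hsum) :
  hsum_inner x y = (-1) ^+ false * (hsum_inner y x)^*%R.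
Proof.
by rewrite expr0 mul1r rmorphD/= /hsum_inner; congr +%R; rewrite hermC mul1r.
Qed.

HB.instance Definition _ :=
  isHermitianSesquilinear.Build R[i] hsum false (@Num.conj R[i]) hsum_inner
    hsum_inner_herm.

Lemma sqr_norm_hsum_inner (x : hsum) : `|x| ^+ 2 = hsum_inner x x.
Proof. by rewrite normE_hsum sqr_hsum_norm !sqr_norm_inner. Qed.

Let hsum_inner_gt0 (x : hsum) : x != 0 -> 0 < hsum_inner x x.
Proof. by move=> x0; rewrite -sqr_norm_hsum_inner exprn_gt0 ?normr_gt0. Qed.

HB.instance Definition _ := isDotProduct.Build R[i] hsum hsum_inner
  hsum_inner_gt0.

HB.instance Definition _ := CompleteNormedModule_isHilbert.Build R hsum
  sqr_norm_hsum_inner.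

End direct_sum_norm.

Section operators.
Variable R : realType.

(* A linear operator from a subspace of U to V, given by its graph. *)
Record linop (U V : hilbertType R) := Linop {
  graph : set (U * V);
  graph0 : graph 0;
  graphP : forall (a : R[i]) p q, graph p -> graph q -> graph (a *: p + q);
  graph_fun : forall x y y', graph (x, y) -> graph (x, y') -> y = y'
}.

Definition bounded_op (U V : hilbertType R) (f : U -> V) :=
  exists M : R[i], forall x, `|f x| <= M * `|x|.

Definition finite_dim (V : hilbertType R) (E : set V) :=
  exists n (e : 'I_n -> V),
    E = [set x | exists c : 'I_n -> R[i], x = \sum_(i < n) c i *: e i].

Definition orthogonal_compl (V : hilbertType R) (E : set V) : set V :=
  [set y | forall x, E x -> inner x y = 0].

Lemma orthogonal_compl0 (V : hilbertType R) (E : set V) : orthogonal_compl E 0.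
Proof. by move=> z _; rewrite linear0r. Qed.

Lemma orthogonal_complP (V : hilbertType R) (E : set V) (a : R[i]) x y :
  orthogonal_compl E x -> orthogonal_compl E y ->
  orthogonal_compl E (a *: x + y).
Proof. by move=> Ex Ey z Ez; rewrite linearPr/= Ex// Ey// mulr0 addr0. Qed.

Lemma orthogonal_compl_cap (V : hilbertType R) (E : set V) x :
  E x -> orthogonal_compl E x -> x = 0.
Proof.
move=> Ex /(_ _ Ex)/eqP; rewrite -sqr_norm_inner expf_eq0/= normr_eq0.
by move/eqP.
Qed.

Section domain_range_kernel.
Variables (U V : hilbertType R) (T : linop U V).

Definition dom : set U := [set x | exists y, graph T (x, y)].
Definition ran : set V := [set y | exists x, graph T (x, y)].
Definition ker : set U := [set x | graph T (x, 0)].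
Definition coker : set V := orthogonal_compl ran.

Definition closed_op := closed (graph T).

Definition gen_inv_graph : set (V * U) := [set p |
  exists y z, [/\ p.1 = y + z, coker z, graph T (p.2, y) &
                  orthogonal_compl ker p.2]].

Let gen_inv0 : gen_inv_graph 0.
Proof.
by exists 0, 0; split; [rewrite addr0 | exact: orthogonal_compl0
  | exact: graph0 | exact: orthogonal_compl0].
Qed.

Let gen_invP (a : R[i]) p q :
  gen_inv_graph p -> gen_inv_graph q -> gen_inv_graph (a *: p + q).
Proof.
move=> [y [z [pE Cz Ty Kp]]] [y' [z' [qE Cz' Ty' Kq]]].
exists (a *: y + y'), (a *: z + z'); split.
- by rewrite /= pE qE scalerDr addrACA.
- exact: orthogonal_complP.
- exact: (graphP a Ty Ty').
- exact: orthogonal_complP.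
Qed.

Let gen_inv_fun v x x' :
  gen_inv_graph (v, x) -> gen_inv_graph (v, x') -> x = x'.
Proof.
have sub (W W' : hilbertType R) (S : linop W W') w1 w2 w1' w2' :
    graph S (w1, w2) -> graph S (w1', w2') -> graph S (w1 - w1', w2 - w2').
  move=> S1 S2; have := graphP (-1) S2 S1.
  by rewrite scaleN1r addrC.
have subC (W : hilbertType R) (E : set W) w w' : orthogonal_compl E w ->
    orthogonal_compl E w' -> orthogonal_compl E (w - w').
  by move=> Ew Ew'; rewrite addrC -scaleN1r; exact: orthogonal_complP.
move=> [y [z [/= vE Cz Ty Kx]]] [y' [z' [/= v'E Cz' Ty' Kx']]].
have Tyy := sub _ _ _ _ _ _ _ Ty Ty'.
have yyE : y - y' = z' - z.
  by apply/eqP; rewrite subr_eq eq_sym addrAC subr_eq (addrC z') -v'E vE.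
have yy0 : y - y' = 0.
  apply: (@orthogonal_compl_cap _ ran); first by exists (x - x').
  by rewrite yyE; exact: subC.
apply/eqP; rewrite -subr_eq0; apply/eqP.
apply: (@orthogonal_compl_cap _ ker); last exact: subC.
by rewrite /ker/= -yy0.
Qed.

(* The generalised inverse T^#: on y + z, with y in the range and z in the
   cokernel, its value is the preimage of y orthogonal to the kernel. *)
Definition gen_inv : linop V U := Linop gen_inv0 gen_invP gen_inv_fun.

End domain_range_kernel.

Definition F_plus (V : hilbertType R) (T : linop V V) :=
  [/\ closed_op T, closed (ran T) & finite_dim (ker T)].

(* S is (T - lam)^-1: it is everywhere defined, and its graph is the inverse
   of the graph {(x, y - lam x) : (x, y) in the graph of T} of T - lam. *)
Definition resolvent_set (V : hilbertType R) (T : linop V V) : set R[i] :=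
  [set lam | exists S : {linear V -> V}, bounded_op S /\
     forall x z, S z = x <-> graph T (x, z + lam *: x)].

(* An inclusion of Hilbert spaces, X being a subspace of Y up to emb. *)
Record embedding (X Y : hilbertType R) := Embedding {
  emb :> {linear X -> Y};
  emb_inj : injective emb;
  emb_continuous : continuous emb
}.

Lemma comp_emb_continuous (X Y Z : hilbertType R) (e : embedding X Y)
  (f : embedding Y Z) : continuous (f \o e).
Proof.
move=> x; apply: continuous_comp; exact: emb_continuous.
Qed.

Definition comp_emb (X Y Z : hilbertType R) (e : embedding X Y)
    (f : embedding Y Z) : embedding X Z :=
  @Embedding X Z (f \o e) (inj_comp (@emb_inj _ _ f) (@emb_inj _ _ e))
    (@comp_emb_continuous _ _ _ e f).

Lemma fst_hsum_continuous (U V : hilbertType R) :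
  continuous (fst : hsum U V -> U).
Proof.
move=> x; apply/(@cvgrPdist_lt _ _ _ (nbhs x)) => e e0; near=> y.
apply: le_lt_trans (norm_fst_hsum (x - y)) _.
by near: y; exact: cvgr_dist_lt.
Unshelve. all: by end_near. Qed.

Lemma snd_hsum_continuous (U V : hilbertType R) :
  continuous (snd : hsum U V -> V).
Proof.
move=> x; apply/(@cvgrPdist_lt _ _ _ (nbhs x)) => e e0; near=> y.
apply: le_lt_trans (norm_snd_hsum (x - y)) _.
by near: y; exact: cvgr_dist_lt.
Unshelve. all: by end_near. Qed.

Section embedding_sum.
Variables (X1 X2 Y1 Y2 : hilbertType R).
Variables (e1 : embedding X1 Y1) (e2 : embedding X2 Y2).

Definition hsum_map (x : hsum X1 X2) : hsum Y1 Y2 := (e1 x.1, e2 x.2).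

Let hsum_map_linear : linear hsum_map.
Proof. by move=> a x y; rewrite /hsum_map/= !linearP. Qed.

HB.instance Definition _ := GRing.isLinear.Build R[i] (hsum X1 X2)
  (hsum Y1 Y2) *:%R hsum_map hsum_map_linear.

Let hsum_map_inj : injective hsum_map.
Proof. by move=> [x1 x2] [y1 y2] [/emb_inj-> /emb_inj->]. Qed.

Let hsum_map_continuous : continuous hsum_map.
Proof.
move=> x; apply/(@cvgrPdist_lt _ _ _ (nbhs x)) => e e0.
have c1 : continuous (e1 \o (fst : hsum X1 X2 -> X1)).
  by move=> y; apply: continuous_comp;
    [exact: fst_hsum_continuous | exact: emb_continuous].
have c2 : continuous (e2 \o (snd : hsum X1 X2 -> X2)).
  by move=> y; apply: continuous_comp;
    [exact: snd_hsum_continuous | exact: emb_continuous].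
have {}c1 := (cvgrPdist_lt _ _).1 (c1 x) _ (divr_gt0 e0 (ltr0Sn _ 1)).
have {}c2 := (cvgrPdist_lt _ _).1 (c2 x) _ (divr_gt0 e0 (ltr0Sn _ 1)).
near=> y; rewrite [e]splitr; apply: le_lt_trans (norm_hsum_le _) _.
by apply: ltrD; near: y; [exact: c1 | exact: c2].
Unshelve. all: by end_near. Qed.

Definition hsum_emb : embedding (hsum X1 X2) (hsum Y1 Y2) :=
  Embedding hsum_map_inj hsum_map_continuous.

End embedding_sum.

Section part.
Variables (X Y Z : hilbertType R).
Variables (e : embedding X Y) (f : embedding Y Z) (T : {linear X -> Z}).

Definition part_graph : set (Y * Y) :=
  [set p | exists2 x, e x = p.1 & T x = f p.2].

Let part0 : part_graph 0. Proof. by exists 0; rewrite linear0 /= ?linear0. Qed.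

Let partP (a : R[i]) p q :
  part_graph p -> part_graph q -> part_graph (a *: p + q).
Proof.
move=> [x ex Tx] [y ey Ty]; exists (a *: x + y); rewrite linearP.
  by rewrite ex ey.
by rewrite Tx Ty /= linearP.
Qed.

Let part_fun y z z' : part_graph (y, z) -> part_graph (y, z') -> z = z'.
Proof.
move=> [x /= <- Tx] [x' /= /emb_inj -> Tx']; apply: (@emb_inj _ _ f).
by rewrite -Tx -Tx'.
Qed.

(* For X in Y in Z: the restriction of T : X -> Z to {x in X : T x in Y},
   as an operator in Y. *)
Definition part : linop Y Y := Linop part0 partP part_fun.

End part.

Definition schur (X1 X2 Z1 Z2 : hilbertType R) (A : {linear X1 -> Z1})
    (B : {linear X2 -> Z1}) (C : {linear X1 -> Z2}) (Dd : {linear Z2 -> X2}) :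
    {linear X1 -> Z1} :=
  A \- (B \o (Dd \o C)).

Section block.
Variables (X1 X2 Z1 Z2 : hilbertType R).
Variables (A : {linear X1 -> Z1}) (B : {linear X2 -> Z1}).
Variables (C : {linear X1 -> Z2}) (D : {linear X2 -> Z2}).

Definition block_fun (x : hsum X1 X2) : hsum Z1 Z2 :=
  (A x.1 + B x.2, C x.1 + D x.2).

Let row_linear (Z : hilbertType R) (f : {linear X1 -> Z})
    (g : {linear X2 -> Z}) a (x1 y1 : X1) (x2 y2 : X2) :
  f (a *: x1 + y1) + g (a *: x2 + y2) = a *: (f x1 + g x2) + (f y1 + g y2).
Proof. by rewrite !linearP scalerDr addrACA. Qed.

Let block_linear : linear block_fun.
Proof.
move=> a [x1 x2] [y1 y2].
by rewrite /block_fun/= (row_linear A B) (row_linear C D).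
Qed.

HB.instance Definition _ := GRing.isLinear.Build R[i] (hsum X1 X2)
  (hsum Z1 Z2) *:%R block_fun block_linear.

Definition block : {linear hsum X1 X2 -> hsum Z1 Z2} := block_fun.

End block.

End operators.

(* Main.v *)
Require Import Defs.
From HB Require Import structures.
From mathcomp Require Import all_boot all_order all_algebra.
From mathcomp Require Import sesquilinear complex.
From mathcomp Require Import ring lra.
From mathcomp Require Import all_classical all_reals all_analysis.

Import Order.TTheory GRing.Theory Num.Theory.
Import numFieldNormedType.Exports.

Local Open Scope classical_set_scope.
Local Open Scope complex_scope.
Local Open Scope ring_scope.

(* Eliminating the second component with [Dd] and then the first with [Sd]
   gives a bounded [L] from [H] to [DS (+) D2] with [x - L (A0 x)] in a fixed
   subspace [F] for every [x] in the domain of [A0]. In (i) [F = 0], so [L] is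
   the inverse of [A0]. In (ii) [F] is finite-dimensional: by density,
   [1 - Dd D] and [1 - Sd S] map into the kernels of [D0] and [S0]. The graph
   and the range of [A0] are then preimages, under continuous maps built from
   [L], of finite-dimensional and hence closed subspaces. [L] is bounded
   because [B Dd], which is only bounded from [H2] to [D_{-1}], has its values
   in [D_{-S}], so that the closed graph theorem applies. *)

(** * Baire category and the closed graph theorem over the reals *)

Section closed_graph.
Context {R : realType} {X Y : completeNormedModType R}.
Variable T : {linear X -> Y}.

(** The sets [E n] cover [X], so by Baire the closure of one of them contains a ball. A small vector
    is the difference of two points of that ball, hence is approximated by differences of points of
    [E n]. Scaling gives the claim for all vectors. *)
Lemma baire_approx : exists M, 0 <= M /\
  forall x, exists y, `|x - y| <= `|x| / 2 /\ `|T y| <= M * `|x|.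
Proof.
pose E n := [set x | `|T x| <= n%:R].
pose O n := ~` closure (E n).
have [n /denseNE[U [[x0 /open_nbhs_nbhs/nbhs_ballP[r /= r0 rU]] UO]]] :
    exists n, ~ dense (O n).
  apply: contrapT => /forallNP dO.
  have /Baire : forall n, open (O n) /\ dense (O n).
    move=> n; split; last by have := dO n; apply: contrapT.
    by apply: closed_openC; exact: closed_closure.
  move=> /(_ setT); case; [by exists 0 | exact: openT|].
  move=> x [_ /(_ (Num.truncn `|T x|).+1 I)]; apply.
  by apply: subset_closure; rewrite /E/= ltW// truncnS_gt.
have clE y : ball x0 r y -> closure (E n) y.
  by move=> /rU Uy; apply: contrapT => Oy; rewrite -[False]/(set0 y) -UO.
have approx e x : 0 < e -> `|x| < r ->
    exists y, `|x - y| < e /\ `|T y| <= n%:R + n%:R.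
  move=> e0 xr; have e20 : 0 < e / 2 by rewrite divr_gt0.
  have clx : closure (E n) (x0 + x).
    by apply: clE; rewrite -ball_normE /ball_/= opprD addrA subrr sub0r normrN.
  have clx0 : closure (E n) x0 by apply: clE; exact: ballxx.
  have [y1 []] := clx _ (nbhsx_ballx _ _ e20).
  rewrite /E/= -ball_normE /ball_/= => Ty1 xy1.
  have [y2 []] := clx0 _ (nbhsx_ballx _ _ e20).
  rewrite /E/= -ball_normE /ball_/= => Ty2 xy2.
  exists (y1 - y2); split.
    have -> : x - (y1 - y2) = (x0 + x - y1) - (x0 - y2).
      rewrite !opprB (addrC x0) -!addrA; congr (_ + _).
      by rewrite [RHS]addrCA [x0 + _]addrC subrK addrC.
    by rewrite [e]splitr (le_lt_trans (ler_normB _ _))// ltrD.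
  by rewrite linearB (le_trans (ler_normB _ _))// lerD.
exists ((n%:R + n%:R) * 2 / r); split=> [|x].
  by rewrite divr_ge0 ?mulr_ge0 ?addr_ge0 ?(ltW r0).
have [->|x0'] := eqVneq x 0.
  by exists 0; rewrite subr0 linear0 !normr0 mulr0 mul0r.
have xp : 0 < `|x| by rewrite normr_gt0.
(* [c *: x] has norm [r / 2], inside the ball; an error of [r / 4] becomes half the norm of [x]
   after scaling back. *)
pose c := r / (2 * `|x|).
have c0 : 0 < c by rewrite divr_gt0// mulr_gt0.
have cx : c * `|x| = r / 2 by rewrite /c; field; rewrite gt_eqF.
have [||y [xy Ty]] := approx (r / 4) (c *: x).
- by rewrite divr_gt0.
- by rewrite normrZ gtr0_norm// cx; lra.
exists (c^-1 *: y); split.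
  have -> : x - c^-1 *: y = c^-1 *: (c *: x - y).
    by rewrite scalerBr scalerA mulVf ?gt_eqF// scale1r.
  rewrite normrZ gtr0_norm ?invr_gt0// ler_pdivrMl// mulrA cx.
  by rewrite (le_trans (ltW xy))//; lra.
rewrite linearZ normrZ gtr0_norm ?invr_gt0// ler_pdivrMl//.
rewrite mulrCA cx (le_trans Ty)// -mulrA mulrC.
by rewrite (_ : _ * _ = n%:R + n%:R)//; field; rewrite gt_eqF.
Qed.

(** Iterating [baire_approx] halves the remainder [xs n] each time, so the series of the
    [T (g (xs n))] is dominated by a geometric one with sum [M / (1 - 2^-1)] times the norm of [x].
    It converges since [Y] is complete; that its sum is [T x] is checked in [Z], where [e \o T] is
    continuous. *)
Lemma closed_graph (Z : normedModType R) (e : {linear Y -> Z}) :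
  injective e -> continuous e -> continuous (e \o T) ->
  exists M, forall x, `|T x| <= M * `|x|.
Proof.
move=> einj econt eTcont.
have [M [M0 /choice[g gP]]] := baire_approx.
exists (M / (1 - 2^-1)) => x.
pose xs n := iter n (fun z => z - g z) x.
have xsle n : `|xs n| <= `|x| * 2^-1 ^+ n.
  elim: n => [|n IH]; first by rewrite expr0 mulr1.
  by rewrite exprSr mulrA (le_trans (gP _).1)// ler_wpM2r// invr_ge0.
pose u n := T (g (xs n)).
have ule n : `|u n| <= geometric (M * `|x|) 2^-1 n.
  by rewrite /= -mulrA (le_trans (gP _).2)// ler_wpM2l.
have seru n : series u n = T (x - xs n).
  elim: n => [|n IH]; first by rewrite seriesEnat/= big_geq// subrr linear0.
  rewrite seriesSr IH -linearD; congr (T _).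
  by rewrite /xs iterS opprB -addrA [_ + g _]addrC.
have half : `|2^-1 : R| < 1 by rewrite ger0_norm ?invr_ge0// invf_lt1// ltr1n.
have ucvg : cvgn (series u).
  apply: normed_cvg; apply: series_le_cvg ule _ => [n|n|].
  - exact: normr_ge0.
  - by rewrite /= mulr_ge0 ?exprn_ge0 ?invr_ge0// mulr_ge0.
  - exact: is_cvg_geometric_series.
have xs0 : xs n @[n --> \oo] --> 0.
  apply/norm_cvg0P; apply: squeeze_cvgr (cvg_cst 0) (cvg_geometric `|x| half).
  by near=> n; rewrite normr_ge0 xsle.
have -> : T x = limn (series u).
  apply: einj; have : (e \o T) (x - xs n) @[n --> \oo] --> (e \o T) (x - 0).
    apply: continuous_cvg; first exact: eTcont.
    by apply: cvgB => //; exact: cvg_cst.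
  rewrite subr0 (_ : (fun n => _) = e \o series u); last first.
    by apply/funext => n /=; rewrite -seru.
  move=> /(cvg_unique (@norm_hausdorff _ _)); apply => //.
  by apply: continuous_cvg; [exact: econt | exact: ucvg].
rewrite mulrAC; apply: (closed_cvg (fun y => `|y| <= _)) ucvg.
  apply: (@preimage_closed _ _ (@Num.norm _ Y) [set t | t <= _]).
    by move=> y _; exact: norm_continuous.
  exact: closed_le.
near=> n; rewrite seriesEnat/= (le_trans (ler_norm_sum _ _ _))//.
rewrite (le_trans (ler_sum _ (fun i _ => ule i)))//.
have := @geometric_le_lim R n (M * `|x|) 2^-1; rewrite seriesEnat/=; apply => //.
by rewrite mulr_ge0.
Unshelve. all: by end_near. Qed.

End closed_graph.

(** * Restriction of scalars to the reals; bounded and continuous operators *)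

Section realification.
Context {R : realType}.
Implicit Type V : completeNormedModType R[i].

Lemma Re_norm V (x : V) : (complex.Re `|x|)%:C = `|x|.
Proof. by rewrite RRe_real ?normr_real. Qed.

Lemma gt0_ReP (e : R[i]) : 0 < e -> exists2 r : R, 0 < r & e = r%:C.
Proof.
move=> e0; have /RRe_real eE := gtr0_real e0.
by exists (complex.Re e); rewrite ?eE// -ltcR eE.
Qed.

(* A complex Banach space with scalars restricted to R, for which the library
   has Baire's theorem. *)
Definition realification V : Type := V.

HB.instance Definition _ V := GRing.Zmodule.copy (realification V) V.

Section instances.
Variable V : completeNormedModType R[i].

Definition real_scale (a : R) (x : realification V) : realification V :=
  a%:C *: (x : V).

Let real_scaleA a b x : real_scale a (real_scale b x) = real_scale (a * b) x.
Proof. by rewrite /real_scale scalerA rmorphM. Qed.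

Let real_scale1 : left_id 1 real_scale.
Proof. by move=> x; rewrite /real_scale scale1r. Qed.

Let real_scaleDr : right_distributive real_scale +%R.
Proof. by move=> a x y; rewrite /real_scale scalerDr. Qed.

Let real_scaleDl x : {morph real_scale^~ x : a b / a + b}.
Proof. by move=> a b; rewrite /real_scale rmorphD scalerDl. Qed.

HB.instance Definition _ := GRing.Zmodule_isLmodule.Build R (realification V)
  real_scaleA real_scale1 real_scaleDr real_scaleDl.

Definition real_norm (x : realification V) : R := complex.Re `|x : V|.

Let real_normD x y : real_norm (x + y) <= real_norm x + real_norm y.
Proof. by rewrite -lecR rmorphD/= !Re_norm ler_normD. Qed.

Let real_normZ (a : R) x : real_norm (a *: x) = `|a| * real_norm x.
Proof.
apply: complexI; rewrite rmorphM/= !Re_norm normrZ; congr (_ * _).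
by rewrite normc_def/= expr0n/= addr0 sqrtr_sqr.
Qed.

Let real_norm0_eq0 x : real_norm x = 0 -> x = 0.
Proof.
by move=> /(congr1 (real_complex R)); rewrite Re_norm => /eqP; rewrite normr_eq0
  => /eqP.
Qed.

HB.instance Definition _ := Lmodule_isNormed.Build R (realification V)
  real_normD real_normZ real_norm0_eq0.

Lemma normC_realification (x : realification V) : `|x|%:C = `|x : V|.
Proof. exact: Re_norm. Qed.

Let realification_complete (F : set_system (realification V)) :
  ProperFilter F -> cauchy F -> cvg F.
Proof.
move=> FF /cauchyP Fc.
have /(@cauchy_exP _ V)/cauchy_cvg/cvg_ex[u Fu] : @cauchy_ex _ V F.
  move=> _ /gt0_ReP[r r0 ->]; have [x Fx] := Fc r r0; exists x.
  apply: filterS Fx => y; rewrite -!ball_normE /ball_/=.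
  by rewrite -ltcR normC_realification.
apply/cvg_ex; exists (u : realification V); apply/fcvgrPdist_lt => e e0.
have e0' : 0 < e%:C by rewrite ltcR.
have := (@fcvgrPdist_lt _ V F (@filter_filter _ _ FF) u).1 Fu _ e0'.
by apply: (@filterS _ F) => y; rewrite -ltcR normC_realification.
Qed.

HB.instance Definition _ := Uniform_isComplete.Build (realification V)
  realification_complete.

End instances.

(** The bound only forces the product of [M] with each norm to be nonnegative; if [X] is trivial,
    [M] itself may be non-real. Hence the passage to its modulus. *)
Lemma bounded_opP (X Y : hilbertType R) (f : X -> Y) :
  bounded_op f -> exists M : R, forall x, `|f x| <= M%:C * `|x|.
Proof.
move=> [M fM]; exists (complex.Re `|M|) => x; apply: le_trans (fM x) _.
have M0 := le_trans (normr_ge0 _) (fM x).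
by rewrite RRe_real ?normr_real// -(ger0_norm M0) normrM normr_id.
Qed.

Lemma bounded_continuous {K : realFieldType} (X Y : normedModType K)
    (f : {linear X -> Y}) (M : K) :
  (forall x, `|f x| <= M * `|x|) -> continuous f.
Proof.
move=> fM; apply/linear_bounded_continuous/linear_boundedP; near=> r => x.
by rewrite (le_trans (fM x))// ler_wpM2r.
Unshelve. all: by end_near. Qed.

Lemma bounded_op_linearP (X Y : hilbertType R) (T : {linear X -> Y}) :
  bounded_op T <-> continuous T.
Proof.
split=> [/bounded_opP[M TM]|/linear_bounded_continuous/linear_boundedP].
  apply/linear_bounded_continuous/linear_boundedP; near=> r => x.
  rewrite (le_trans (TM x))// ler_wpM2r//; near: r; apply: nbhs_pinfty_ge.
  by apply/complex_realP; exists M.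
move=> [M [Mreal TM]]; exists (M + 1) => x; apply: TM.
by rewrite ltrDl.
Unshelve. all: by end_near. Qed.

(* The closed graph theorem: [T] has a closed graph because it is continuous
   for the coarser topology that [e] induces on [Y]. *)
Lemma closed_graph_continuous (X Y Z : hilbertType R) (e : {linear Y -> Z})
    (T : {linear X -> Y}) :
  injective e -> continuous e -> continuous (e \o T) -> continuous T.
Proof.
move=> einj /bounded_op_linearP/bounded_opP[a ea].
move=> /(@bounded_op_linearP _ _ (e \o T))/bounded_opP[b eTb].
have real_lin (U V : hilbertType R) (f : {linear U -> V}) :
  @GRing.linear_for R (realification U) (realification V) *:%R f.
  by move=> c x y; rewrite linearP.
pose real (U V : hilbertType R) (f : {linear U -> V}) :
  {linear realification U -> realification V} :=
  HB.pack (f : realification U -> realification V)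
    (GRing.isLinear.Build _ _ _ _ _ (real_lin _ _ f)).
have real_bnd (U V : hilbertType R) (f : {linear U -> V}) (c : R) :
    (forall x, `|f x| <= c%:C * `|x|) -> continuous (real _ _ f).
  move=> fc; apply: (@bounded_continuous _ _ _ _ c) => x.
  by rewrite -lecR rmorphM/= !normC_realification; exact: fc.
have [||M TM] := @closed_graph R _ _ (real _ _ T) _ (real _ _ e) einj.
- exact: real_bnd ea.
- exact: (real_bnd _ _ (e \o T) _ eTb).
apply/bounded_op_linearP; exists M%:C => x.
by have := TM x; rewrite -lecR rmorphM/= !normC_realification.
Qed.

End realification.

(** * Orthogonal projection onto closed subspaces *)

Section hilbert.
Context {R : realType} {V : hilbertType R}.
Implicit Types (E : set V) (u v x y z : V).

Definition subspace E :=
  E 0 /\ forall (a : R[i]) x y, E x -> E y -> E (a *: x + y).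

Lemma subspaceZ E a x : subspace E -> E x -> E (a *: x).
Proof. by move=> [E0 EP] Ex; rewrite -[_ *: _]addr0; exact: EP. Qed.

Lemma subspaceD E x y : subspace E -> E x -> E y -> E (x + y).
Proof. by move=> [_ EP] Ex Ey; rewrite -[x]scale1r; exact: EP. Qed.

Lemma subspaceB E x y : subspace E -> E x -> E y -> E (x - y).
Proof.
by move=> [_ EP] Ex Ey; rewrite addrC -scaleN1r; exact: EP.
Qed.

Lemma line_projection v : exists q : {linear V -> V},
  [/\ continuous q, q v = v, (forall x, exists a, q x = a *: v) &
      forall x, inner (x - q x) v = 0].
Proof.
(* For [v = 0] this is the zero map, which still has the four properties. *)
pose f x : V := (inner x v / inner v v) *: v.
have flin : linear f.
  by move=> a x y; rewrite /f linearPl/= mulrDl -mulrA scalerDl scalerA.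
pose q : {linear V -> V} := HB.pack f (GRing.isLinear.Build _ _ _ _ _ flin).
have orth x : inner (x - q x) v = 0.
  have [->|v0] := eqVneq v 0; first by rewrite linear0r.
  by rewrite linearBl linearZl_LR/= divfK ?subrr// dnorm_eq0.
exists q; split=> //.
- apply: (@bounded_op_linearP _ _ _ q).1; exists 1 => x; rewrite mul1r.
  rewrite -(@ler_pXn2r _ 2) ?nnegrE// -[in leRHS](subrK (q x) x).
  rewrite !sqr_norm_inner hnormDd; first by rewrite lerDr dnorm_ge0.
  by rewrite linearZr/= orth mulr0.
- have [->|v0] := eqVneq v 0; first by rewrite linear0.
  by rewrite /q/= /f divff ?scale1r// dnorm_eq0.
- by move=> x; exists (inner x v / inner v v).
Qed.

Lemma parallelogram x y :
  `|x - y| ^+ 2 + `|x + y| ^+ 2 = 2 * `|x| ^+ 2 + 2 * `|y| ^+ 2.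
Proof. by rewrite !sqr_norm_inner dnormB dnormD; ring. Qed.

(** By the parallelogram law, points of [E] whose distance to [v] is nearly minimal are close to
    each other. They form a Cauchy filter, whose limit is the minimiser. *)
Lemma nearest_point E v : subspace E -> closed E ->
  exists2 z, E z & forall y, E y -> `|v - z| <= `|v - y|.
Proof.
move=> sE cE; pose nr u := complex.Re `|u|.
have nrE u : (nr u)%:C = `|u| by rewrite Re_norm.
have nr0 u : 0 <= nr u by rewrite -ler0c nrE.
have nrD u w : nr (u + w) <= nr u + nr w.
  by rewrite -lecR rmorphD/= !nrE ler_normD.
pose D := [set nr (v - y) ^+ 2 | y in E]; pose d := inf D.
have D0 : D !=set0 by exists (nr (v - 0) ^+ 2), 0 => //; exact: sE.1.
have Dlb : has_lbound D by exists 0 => _ [y _ <-]; exact: exprn_ge0.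
have dE y : E y -> d <= nr (v - y) ^+ 2 by move=> Ey; apply: ge_inf => //; exists y.
pose B (e : R) := [set y | E y /\ nr (v - y) ^+ 2 < d + e].
have B0 e : 0 < e -> B e !=set0.
  move=> e0; have [_ [y Ey <-] yd] := @inf_adherent _ D e e0 (conj D0 Dlb).
  by exists y.
(* The midpoint of [y] and [y'] lies in [E], so its squared distance to [v] is at least [d]. *)
have Bd e y y' : B e y -> B e y' -> nr (y' - y) ^+ 2 < 4 * e.
  move=> [Ey yd] [Ey' yd'].
  have Em : E (2^-1 *: (y + y')) by apply: subspaceZ => //; exact: subspaceD.
  have /(congr1 (@complex.Re R)) := parallelogram (v - y) (v - y').
  have -> : v - y - (v - y') = y' - y by rewrite opprB addrC addrA subrK.
  have -> : v - y + (v - y') = 2 *: (v - 2^-1 *: (y + y')).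
    by rewrite scalerBr scalerA divff// scale1r scaler_nat mulr2n opprD addrACA.
  rewrite normrZ exprMn -!nrE.
  have -> : `|2 : R[i]| = 2%:C by rewrite normr_nat rmorph_nat.
  rewrite -[X in X * _ + X * _](rmorph_nat (real_complex R)).
  rewrite -!rmorphXn -!rmorphM -!rmorphD/=.
  have := dE _ Em; lra.
pose F := filter_from [set e : R | 0 < e] B.
have BS e e' : e <= e' -> B e `<=` B e'.
  by move=> ee' y [Ey yd]; split=> //; rewrite (lt_le_trans yd)// lerD2l.
have FF : ProperFilter F.
  apply: filter_from_proper; last exact: B0.
  apply: filter_from_filter; first by exists 1; exact: ltr01.
  move=> i j /= i0 j0; exists (Num.min i j); first by rewrite /= lt_min i0.
  by rewrite subsetI; split; apply: BS; rewrite ge_min lexx ?orbT.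
have /(@cauchy_exP _ V)/cauchy_cvg/cvg_ex[z Fz] : cauchy_ex F.
  move=> _ /gt0_ReP[r r0 ->]; have r24 : 0 < r ^+ 2 / 4 by rewrite divr_gt0 ?exprn_gt0.
  have [y By] := B0 _ r24; exists y, (r ^+ 2 / 4) => // y' By'.
  rewrite -ball_normE/= -nrE ltcR -(@ltr_pXn2r _ 2) ?nnegrE ?(ltW r0)//.
  by have := Bd _ _ _ By' By; rewrite mulrC divfK.
have Ez : E z.
  apply: (@closed_cvg _ _ F _ id E cE _ z Fz).
  by exists 1; [exact: ltr01|move=> y []].
exists z => // y Ey; rewrite -!nrE lecR.
have d0 : 0 <= d by apply: lb_le_inf => // _ [w _ <-]; exact: exprn_ge0.
set q := Num.sqrt d; have qd : q ^+ 2 = d by exact: sqr_sqrtr.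
have q0 : 0 <= q by exact: sqrtr_ge0.
apply: (@le_trans _ _ q); last first.
  by rewrite -(@ler_pXn2r _ 2) ?nnegrE// qd dE.
rewrite leNgt; apply/negP => qz.
(* A point [w] of [E] within [e] of [z] and at distance less than [q + e] from [v] contradicts the
   triangle inequality, as [q + 2 e] is the distance from [v] to [z]. *)
pose e := (nr (v - z) - q) / 2.
have e0 : 0 < e by rewrite divr_gt0// subr_gt0.
have ee0 : 0 < (q + e) ^+ 2 - d.
  by rewrite -qd subr_gt0 ltr_pXn2r ?nnegrE ?addr_ge0 ?(ltW e0)// ltrDl.
have e0' : 0 < e%:C by rewrite ltcR.
have := (@fcvgrPdist_lt _ V F (@filter_filter _ _ FF) z).1 Fz _ e0'.
have FB : F (B ((q + e) ^+ 2 - d)) by exists ((q + e) ^+ 2 - d).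
move=> /(filterI FB)/filter_ex[w [[Ew]]].
rewrite (addrC d) subrK ltr_pXn2r ?nnegrE ?addr_ge0 ?(ltW e0)// => vw.
rewrite -nrE ltcR => zw.
have := nrD (v - w) (w - z); rewrite addrA subrK.
have -> : nr (w - z) = nr (z - w) by rewrite /nr distrC.
have : e * 2 = nr (v - z) - q by rewrite /e divfK.
lra.
Qed.

(** Let [y] be the point of [E] nearest to [v]. If [v - y] had a nonzero projection onto the line of
    some [w] in [E], adding it to [y] would, by Pythagoras, give a nearer point. *)
Lemma orthogonal_decomposition E v : subspace E -> closed E ->
  exists y z, [/\ v = y + z, E y & orthogonal_compl E z].
Proof.
move=> sE cE; have [y Ey ymin] := nearest_point E v sE cE.
exists y, (v - y); split; rewrite ?[y + _]addrC ?subrK// => w Ew.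
have [q [_ _ qE orth]] := line_projection w.
have [a qa] := qE (v - y).
have /ymin : E (y + q (v - y)) by rewrite qa addrC; exact: sE.2.
rewrite opprD addrA -(@ler_pXn2r _ 2) ?nnegrE//.
rewrite -[in leLHS](subrK (q (v - y)) (v - y)) !sqr_norm_inner hnormDd; last first.
  by rewrite {2}qa linearZr/= orth mulr0.
rewrite gerDl => q0.
have {}q0 : q (v - y) = 0.
  by apply/eqP; rewrite -normr_eq0 -sqrf_eq0 sqr_norm_inner eq_le q0 dnorm_ge0.
have := orth (v - y); rewrite q0 subr0 => vw.
by rewrite hermC expr0 mul1r; apply/eqP; rewrite conjC_eq0; exact/eqP.
Qed.

End hilbert.

(** * Closed operators and their generalised inverses *)

Section linop.
Context {R : realType} {U V : hilbertType R}.
Variable T : linop U V.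

Lemma graphB x x' y y' :
  graph T (x, y) -> graph T (x', y') -> graph T (x - x', y - y').
Proof.
move=> T1 T2; have := graphP (-1) T2 T1.
by rewrite scaleN1r addrC.
Qed.

Lemma subspace_ran : subspace (ran T).
Proof.
split; first by exists 0; exact: graph0.
by move=> a y y' [x Tx] [x' Tx']; exists (a *: x + x'); exact: (graphP a Tx Tx').
Qed.

Lemma subspace_ker : subspace (ker T).
Proof.
split; first exact: graph0.
move=> a x x' Tx Tx'.
have : graph T (a *: x + x', a *: 0 + 0) := graphP a Tx Tx'.
by rewrite scaler0 addr0.
Qed.

Hypothesis T_closed : closed_op T.

Lemma closed_ker : closed (ker T).
Proof.
apply: (@preimage_closed _ _ (fun x => (x, 0))) T_closed => x _.
by apply: cvg_pair => //=; exact: cvg_cst.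
Qed.

(** [k] is the component of [x] orthogonal to the kernel, which is closed because [T] is; removing
    the kernel component does not change the image. *)
Lemma gen_inv_graphE x y : graph T (x, y) ->
  exists2 k, graph (gen_inv T) (y, k) & ker T (x - k).
Proof.
move=> Txy; have [p [k [xE Kp Kk]]] :=
  orthogonal_decomposition _ x subspace_ker closed_ker.
exists k; last by rewrite xE addrK.
exists y, 0; split; rewrite ?addr0//=; first exact: orthogonal_compl0.
by have := graphB _ _ _ _ Txy Kp; rewrite xE subr0 addrAC subrr add0r.
Qed.

(** A closed range and its orthogonal complement span the space, so the generalised inverse is
    everywhere defined. *)
Lemma gen_inv_total h : closed (ran T) ->
  exists2 k, graph (gen_inv T) (h, k) & dom T k.
Proof.
move=> cT; have [y [z [-> [x Txy] Cz]]] :=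
  orthogonal_decomposition _ h subspace_ran cT.
have [k [y' [z' /= [yE Cz' Tk Kk]]] _] := gen_inv_graphE _ _ Txy.
exists k; last by exists y'.
exists y', (z' + z); split => //=; first by rewrite addrA -yE.
by rewrite -[z']scale1r; exact: orthogonal_complP.
Qed.

End linop.

(** * Finite-dimensional subspaces *)

Section finite_dimension.
Context {R : realType}.

(** The step of the induction on the number of generators. Generators need not be independent, so
    [v] may lie in [E]. *)
Definition add_line {V : hilbertType R} (E : set V) (v : V) : set V :=
  [set x | exists y (a : R[i]), E y /\ x = y + a *: v].

Lemma finite_dim_set0 {V : hilbertType R} : finite_dim [set 0 : V].
Proof.
exists 0, (fun=> 0); apply/seteqP; split=> x /=.
  by move=> ->; exists (fun=> 0); rewrite big_ord0.
by move=> [c ->]; rewrite big_ord0.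
Qed.

Lemma finite_dim_add_line {V : hilbertType R} (E : set V) v :
  finite_dim E -> finite_dim (add_line E v).
Proof.
move=> [n [e ->]].
exists n.+1, (fun i => oapp e v (unlift ord0 i)); apply/seteqP; split=> x /=.
  move=> [_ [a [[c ->] ->]]]; exists (fun i => oapp c a (unlift ord0 i)).
  rewrite big_ord_recl unlift_none addrC; congr (_ + _).
  by apply: eq_bigr => i _; rewrite liftK.
move=> [c ->]; rewrite big_ord_recl unlift_none addrC.
exists (\sum_(i < n) c (lift ord0 i) *: e i), (c ord0); split.
  by exists (fun i => c (lift ord0 i)).
by congr (_ + _); apply: eq_bigr => i _; rewrite liftK.
Qed.

Lemma finite_dim_ind {V : hilbertType R} (P : set V -> Prop) :
  P [set 0] -> (forall E v, finite_dim E -> P E -> P (add_line E v)) ->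
  forall E, finite_dim E -> P E.
Proof.
move=> P0 PS E [n [e ->{E}]]; elim: n e => [|n IH] e.
  rewrite (_ : mkset _ = [set 0])//; apply/seteqP; split=> x /=.
    by move=> [c ->]; rewrite big_ord0.
  by move=> ->; exists (fun=> 0); rewrite big_ord0.
have := PS _ (e ord0) (ex_intro _ n (ex_intro _ _ erefl))
  (IH (fun i => e (lift ord0 i))).
congr P; apply/seteqP; split=> x /=.
  move=> [_ [a [[c ->] ->]]]; exists (fun i => oapp c a (unlift ord0 i)).
  rewrite big_ord_recl unlift_none addrC; congr (_ + _).
  by apply: eq_bigr => i _; rewrite liftK.
move=> [c ->]; rewrite big_ord_recl addrC.
exists (\sum_(i < n) c (lift ord0 i) *: e (lift ord0 i)), (c ord0); split => //.
by exists (fun i => c (lift ord0 i)).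
Qed.

Lemma finite_dim_subspace {V : hilbertType R} (E : set V) :
  finite_dim E -> subspace E.
Proof.
move=> [n [e ->]]; split.
  by exists (fun=> 0); rewrite big1// => i _; rewrite scale0r.
move=> a _ _ [c ->] [d ->]; exists (fun i => a * c i + d i).
by rewrite scaler_sumr -big_split/=; apply: eq_bigr => i _;
  rewrite scalerDl scalerA.
Qed.

(** When a line is added to [E], either [F] is still inside [E], or any [w] in [F] outside [E] has a
    nonzero [v]-coefficient, and subtracting multiples of [w] brings every element of [F] into
    [E]. *)
Lemma subspace_finite_dim {V : hilbertType R} (E F : set V) :
  finite_dim E -> subspace F -> F `<=` E -> finite_dim F.
Proof.
move=> fE; move: E fE F; apply: finite_dim_ind => [F [F0 _] FE|E v fE IH F sF FE].
  rewrite (_ : F = [set 0]); first exact: finite_dim_set0.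
  by apply/seteqP; split=> // x ->.
have fEF : finite_dim (E `&` F).
  apply: IH => [|x []//]; have sE := finite_dim_subspace _ fE.
  split; first by split; [exact: sE.1 | exact: sF.1].
  by move=> a x y [Ex Fx] [Ey Fy]; split; [exact: sE.2 | exact: sF.2].
have [FsubE|] := pselect (F `<=` E).
  by rewrite (_ : F = E `&` F)//; apply/seteqP; split=> x => [Fx|[]//]; split=> //; exact: FsubE.
move=> /existsNP[w /not_implyP[Fw nEw]].
rewrite (_ : F = add_line (E `&` F) w); first exact: finite_dim_add_line.
have sE := finite_dim_subspace _ fE.
have [y [b [Ey wE]]] := FE _ Fw.
have b0 : b != 0 by apply: contra_notN nEw => /eqP b0; rewrite wE b0 scale0r addr0.
apply/seteqP; split=> x.
  move=> Fx; have [z [a [Ez xE]]] := FE _ Fx.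
  exists (x - (a / b) *: w), (a / b); rewrite subrK; split=> //; split.
    rewrite xE wE scalerDr scalerA divfK// opprD addrACA subrr addr0.
    by apply: (subspaceB _ _ _ sE) => //; exact: subspaceZ.
  by apply: (subspaceB _ _ _ sF) => //; exact: subspaceZ.
move=> [z [a [[_ Fz] ->]]].
by apply: subspaceD => //; exact: subspaceZ.
Qed.

Lemma finite_dimD {V : hilbertType R} (E F : set V) :
  finite_dim E -> finite_dim F ->
  finite_dim [set x | exists y z, [/\ E y, F z & x = y + z]].
Proof.
move=> fE; move: F; apply: finite_dim_ind.
  rewrite (_ : mkset _ = E)//; apply/seteqP; split=> x.
    by move=> [y [z [Ey -> ->]]]; rewrite addr0.
  by move=> Ex; exists x, 0; rewrite addr0.
move=> F v fF fEF; rewrite (_ : mkset _ = add_line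
  [set x | exists y z, [/\ E y, F z & x = y + z]] v).
  exact: finite_dim_add_line.
apply/seteqP; split=> x.
  move=> [y [_ [Ey [z [a [Fz ->]]] ->]]]; exists (y + z), a.
  by rewrite addrA; split=> //; exists y, z.
move=> [_ [a [[y [z [Ey Fz ->]]] ->]]]; exists y, (z + a *: v).
by rewrite addrA; split=> //; exists z, a.
Qed.

Lemma finite_dim_image {U V : hilbertType R} (f : {linear U -> V}) (E : set U) :
  finite_dim E -> finite_dim (f @` E).
Proof.
move=> [n [e ->]]; exists n, (f \o e); apply/seteqP; split=> x.
  move=> [_ [c ->] <-]; exists c; rewrite linear_sum.
  by apply: eq_bigr => i _; rewrite linearZ.
move=> [c ->]; exists (\sum_(i < n) c i *: e i); first by exists c.
by rewrite linear_sum; apply: eq_bigr => i _; rewrite linearZ.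
Qed.

Lemma finite_dim_preimage {U V : hilbertType R} (f : {linear U -> V})
    (E : set V) :
  injective f -> E `<=` range f -> finite_dim E -> finite_dim (f @^-1` E).
Proof.
move=> finj + [n [e EE]]; rewrite {}EE => Ef.
have /choice[g gP] : forall i, exists x, f x = e i.
  move=> i; have [|x _ xE] := Ef (e i); last by exists x.
  exists (fun j => (j == i)%:R); rewrite (bigD1 i)//= eqxx scale1r big1 ?addr0//.
  by move=> j /negPf ->; rewrite scale0r.
have fg c : f (\sum_(i < n) c i *: g i) = \sum_(i < n) c i *: e i.
  by rewrite linear_sum; apply: eq_bigr => i _; rewrite linearZ/= gP.
exists n, g; apply/seteqP; split=> x.
  by move=> [c]; rewrite -fg => /finj ->; exists c.
by move=> [c ->]; exists c.
Qed.

(** If [p] retracts onto [E] and [q] projects onto the line of [v - p v], then [p + q (1 - p)]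
    retracts onto [add_line E v], even if [v] is in [E]. Being the fixed points of such a map, [E]
    is closed. *)
Lemma finite_dim_retract {V : hilbertType R} (E : set V) : finite_dim E ->
  exists p : {linear V -> V},
    [/\ continuous p, forall x, E (p x) & forall x, E x -> p x = x].
Proof.
move: E; apply: finite_dim_ind.
  exists (\0 : {linear V -> V}); split=> [x|x|x ->]//.
  exact: cvg_cst.
move=> E v fE [p [pcont Ep pE]].
have [q [qcont qv qline _]] := line_projection (v - p v).
exists (p \+ (q \o (idfun \- p)))%R; split=> [x|x|x].
- apply: cvgD; first exact: pcont.
  apply: (@continuous_comp _ _ _ (fun x => x - p x) q); last exact: qcont.
  by apply: cvgB; [exact: cvg_id | exact: pcont].
- have [a /= ->] := qline (x - p x).
  exists (p x - a *: p v), a; split; last by rewrite scalerBr addrA addrAC.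
  have sE := finite_dim_subspace _ fE.
  by apply: subspaceB => //; exact: subspaceZ.
- move=> [y [a [Ey ->]]] /=; rewrite linearD/= (pE _ Ey) linearZ/=.
  by rewrite opprD addrACA subrr add0r -scalerBr linearZ/= qv scalerBr -addrA
    [_ + (_ - _)]addrC subrK.
Qed.

Lemma closed_fixpoints {V : hilbertType R} (p : V -> V) :
  continuous p -> closed [set x | p x = x].
Proof.
move=> pcont; rewrite (_ : mkset _ = (fun x => p x - x) @^-1` [set 0]).
  apply: preimage_closed => [x _|].
    by apply: cvgB; [exact: pcont | exact: cvg_id].
  exact: accessible_closed_set1 (hausdorff_accessible (@norm_hausdorff _ _)) _.
apply/seteqP; split=> x /= /eqP; last by rewrite subr_eq0 => /eqP.
by rewrite -subr_eq0 => /eqP.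
Qed.

Lemma finite_dim_closed {V : hilbertType R} (E : set V) :
  finite_dim E -> closed E.
Proof.
move=> /finite_dim_retract[p [pcont Ep pE]].
rewrite (_ : E = [set x | p x = x]); first exact: closed_fixpoints.
by apply/seteqP; split=> x; [exact: pE | move=> <-].
Qed.

End finite_dimension.

(** * Direct sums, lifting along embeddings, and regularizers *)

Section regularizer.
Context {R : realType}.

Lemma dense_closed (T : topologicalType) (D A : set T) :
  dense D -> closed A -> D `<=` A -> forall x, A x.
Proof.
move=> dD cA DA x; apply: contrapT => Ax.
have [||y [Ay Dy]] := dD (~` A); first by exists x.
  exact: closed_openC.
by apply: Ay; exact: DA.
Qed.

Lemma hsum_pair_continuous (T : topologicalType) (U V : hilbertType R)
    (f : T -> U) (g : T -> V) :
  continuous f -> continuous g -> continuous (fun t => (f t, g t) : hsum U V).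
Proof.
move=> fcont gcont x; apply/(@cvgrPdist_lt _ _ _ (nbhs x)) => e e0.
have {}fcont := (cvgrPdist_lt _ _).1 (fcont x) _ (divr_gt0 e0 (ltr0Sn _ 1)).
have {}gcont := (cvgrPdist_lt _ _).1 (gcont x) _ (divr_gt0 e0 (ltr0Sn _ 1)).
near=> y; rewrite [e]splitr; apply: le_lt_trans (norm_hsum_le _) _.
by apply: ltrD; near: y; [exact: fcont | exact: gcont].
Unshelve. all: by end_near. Qed.

Lemma hsum_pair_linear (W U V : hilbertType R) (f : {linear W -> U})
    (g : {linear W -> V}) : exists h : {linear W -> hsum U V},
  forall x, h x = (f x, g x).
Proof.
pose h x : hsum U V := (f x, g x).
have hlin : linear h by move=> a x y; rewrite /h !linearP.
pose h' : {linear W -> hsum U V} :=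
  HB.pack h (GRing.isLinear.Build _ _ _ _ _ hlin).
by exists h'.
Qed.

Lemma finite_dim_hsum (U V : hilbertType R) (E : set U) (F : set V) :
  finite_dim E -> finite_dim F ->
  finite_dim [set x : hsum U V | E x.1 /\ F x.2].
Proof.
move=> fE fF.
have [inl inlE] := hsum_pair_linear _ _ _ (idfun : {linear U -> U})
  (\0 : {linear U -> V}).
have [inr inrE] := hsum_pair_linear _ _ _ (\0 : {linear V -> U})
  (idfun : {linear V -> V}).
have := finite_dimD _ _ (finite_dim_image inl _ fE) (finite_dim_image inr _ fF).
congr finite_dim; apply/seteqP; split=> x.
  move=> [_ [_ [[u Eu <-] [v Fv <-] ->]]]; rewrite inlE inrE /=.
  by rewrite addr0 add0r.
move=> [Ex Fx]; exists (inl x.1), (inr x.2); split.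
- by exists x.1.
- by exists x.2.
- by case: x {Ex Fx} => a b; rewrite inlE inrE/=; congr pair; rewrite ?addr0 ?add0r.
Qed.

(** Injectivity of [e] makes the pointwise lift linear, and the closed graph theorem makes it
    continuous for the finer norm of [Y]. *)
Lemma continuous_lift (X Y Z : hilbertType R) (e : embedding Y Z)
    (f : {linear X -> Z}) :
  continuous f -> (forall x, range e (f x)) ->
  exists g : {linear X -> Y}, continuous g /\ forall x, e (g x) = f x.
Proof.
move=> fcont fe.
have /choice[g gP] : forall x, exists y, e y = f x.
  by move=> x; have [y _ yE] := fe x; exists y.
have glin : linear g.
  by move=> a x y; apply: (@emb_inj _ _ _ e); rewrite linearP !gP linearP.
pose g' : {linear X -> Y} := HB.pack g (GRing.isLinear.Build _ _ _ _ _ glin).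
exists g'; split=> //.
apply: (@closed_graph_continuous _ _ _ _ e g').
- exact: emb_inj.
- exact: emb_continuous.
- by rewrite (_ : e \o g' = f)//; apply/funext => x /=; exact: gP.
Qed.

(* [L] is a left inverse of [T] up to the finite-dimensional [F], so that
   membership in the graph and in the range of the part of [T] reduces, along a
   continuous map, to membership in a finite-dimensional subspace. *)
Lemma F_plus_part (X Y Z : hilbertType R) (i : embedding X Y)
    (j : embedding Y Z) (T : {linear X -> Z}) (L : {linear Y -> X}) (F : set X) :
  continuous T -> continuous L -> finite_dim F ->
  (forall x y, T x = j y -> F (x - L y)) -> F_plus (part i j T).
Proof.
move=> Tcont Lcont fF TF.
have icont := @emb_continuous _ _ _ i; have jcont := @emb_continuous _ _ _ j.
have TLcont : continuous (fun y => j y - T (L y)).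
  move=> y; apply: cvgB; first exact: jcont.
  by apply: (@continuous_comp _ _ _ L T); [exact: Lcont | exact: Tcont].
have TE x y : T x = j y -> T (x - L y) = j y - T (L y).
  by move=> Txy; rewrite linearB Txy.
split.
- have [g gE] := hsum_pair_linear _ _ _ i T.
  (* If [T x = j y2], then [k = x - L y2] is in [F]; the pair [(i x, y2)], corrected by [L y2],
     becomes [(i k, T k)]. Conversely [k + L y2] recovers [x]. *)
  rewrite /closed_op (_ : graph _ = (fun p : Y * Y =>
      (p.1 - i (L p.2), j p.2 - T (L p.2)) : hsum Y Z) @^-1` (g @` F)).
    apply: preimage_closed.
      move=> p _; apply: (@hsum_pair_continuous (Y * Y)%type Y Z
        (fun p => p.1 - i (L p.2)) (fun p => j p.2 - T (L p.2))) => {}p.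
        apply: cvgB; first exact: cvg_fst.
        apply: (@continuous_comp _ _ _ snd (i \o L)); first exact: cvg_snd.
        by apply: (@continuous_comp _ _ _ L i); [exact: Lcont | exact: icont].
      apply: (@continuous_comp _ _ _ snd (fun y => j y - T (L y))).
        exact: cvg_snd.
      exact: TLcont.
    by apply: finite_dim_closed; exact: finite_dim_image.
  apply/seteqP; split=> -[y1 y2] /=.
    move=> [x /= <- Txy]; exists (x - L y2); first exact: TF.
    by rewrite gE TE// linearB.
  move=> [k Fk]; rewrite gE => -[ik Tk]; exists (k + L y2) => /=.
    by rewrite linearD ik subrK.
  by rewrite linearD Tk subrK.
- rewrite (_ : ran _ = (fun y => j y - T (L y)) @^-1` (T @` F)).
    apply: preimage_closed => [y _|]; first exact: TLcont.
    by apply: finite_dim_closed; exact: finite_dim_image.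
  apply/seteqP; split=> y /=.
    by move=> [_ [x /= _ Txy]]; exists (x - L y); [exact: TF | exact: TE].
  move=> [k Fk Tk]; exists (i (k + L y)), (k + L y) => //=.
  by rewrite linearD Tk subrK.
- apply: (subspace_finite_dim (i @` F)).
  + exact: finite_dim_image.
  + exact: subspace_ker.
  + move=> _ [x /= <- Tx0]; exists x => //.
    by have := TF _ _ Tx0; rewrite linear0 subr0.
Qed.

Lemma resolvent_set0P (V : hilbertType R) (T : linop V V) :
  resolvent_set T 0 <-> exists S : {linear V -> V},
    continuous S /\ forall x z, S z = x <-> graph T (x, z).
Proof.
split=> -[S [Sb ST]]; exists S; split; try exact/bounded_op_linearP.
  by move=> x z; rewrite ST scale0r addr0.
by move=> x z; rewrite scale0r addr0.
Qed.

End regularizer.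

(** * Bounded extensions of an operator and of its generalised inverse *)

Section closed_range_extension.
Context {R : realType} {X Y Z : hilbertType R}.
Variables (i : embedding X Y) (j : embedding Y Z) (T0 : linop Y Y).
Variables (T : {linear X -> Z}) (Td : {linear Z -> X}).
Hypothesis T0_closed : closed_op T0.
Hypothesis T_continuous : continuous T.
Hypothesis Td_continuous : continuous Td.
Hypothesis T_ext : forall x y, graph T0 (i x, y) -> T x = j y.
Hypothesis Td_ext :
  forall h k, graph (gen_inv T0) (h, k) -> i (Td (j h)) = k.

(* [1 - Td T] extends the orthogonal projection onto the kernel of [T0]. *)
Lemma ker_extension : dense (i @^-1` dom T0) ->
  forall x, ker T0 (i (x - Td (T x))).
Proof.
move=> domT0; apply: (dense_closed _ _ [set x | ker T0 (i (x - Td (T x)))] domT0).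
  apply: (@preimage_closed _ _ (fun x => i (x - Td (T x)))); last exact: closed_ker.
  move=> x _; apply: (@continuous_comp _ _ _ (fun x => x - Td (T x)) i).
    apply: cvgB; first exact: cvg_id.
    by apply: (@continuous_comp _ _ _ T Td);
      [exact: T_continuous | exact: Td_continuous].
  exact: emb_continuous.
(* On the dense domain, [Td (T x)] is the component [k] of [x] orthogonal to the kernel. *)
move=> x [y T0xy] /=; have [k T0k] := gen_inv_graphE _ T0_closed _ _ T0xy.
by rewrite linearB (T_ext _ _ T0xy) (Td_ext _ _ T0k).
Qed.

End closed_range_extension.

(** * Invertibility and the semi-Fredholm property of the block operator *)

Theorem theorem2p8 (R : realType)
    (H1 H2 DS D2 DmS Dm1 Dm2 : hilbertType R)
    (* D_S < H_1 < D_{-S} < D_{-1} and D_2 < H_2 < D_{-2} *)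
    (iS : embedding DS H1) (iS' : embedding H1 DmS) (iS1 : embedding DmS Dm1)
    (i2 : embedding D2 H2) (i2' : embedding H2 Dm2)
    (dense_iS : dense (range iS)) (dense_iS' : dense (range iS'))
    (dense_i2 : dense (range i2)) (dense_i2' : dense (range i2'))
    (A : {linear DS -> Dm1}) (bounded_A : bounded_op A)
    (B : {linear D2 -> Dm1}) (bounded_B : bounded_op B)
    (C : {linear DS -> Dm2}) (bounded_C : bounded_op C)
    (D0 : linop H2 H2) (closed_D0 : closed_op D0)
    (closed_ran_D0 : closed (ran D0))
    (dom_D0 : dom D0 `<=` range i2) (dense_D0 : dense (i2 @^-1` dom D0))
    (D : {linear D2 -> Dm2}) (bounded_D : bounded_op D)
    (ext_D : forall g h, graph D0 (i2 g, h) -> D g = i2' h)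
    (Dd : {linear Dm2 -> D2}) (bounded_Dd : bounded_op Dd)
    (ext_Dd : forall h k, graph (gen_inv D0) (h, k) -> i2 (Dd (i2' h)) = k) :
  let S : {linear DS -> Dm1} := schur A B C Dd in
  let A0 : linop (hsum H1 H2) (hsum H1 H2) :=
    part (hsum_emb iS i2) (hsum_emb (comp_emb iS' iS1) i2') (block A B C D) in
  let S0 : linop H1 H1 := part iS (comp_emb iS' iS1) S in
  (* SmS is S as a map into D_{-S} *)
  forall (SmS : {linear DS -> DmS}),
    bounded_op SmS -> (forall f, iS1 (SmS f) = S f) ->
    (forall g, dom D0 (i2 g) -> range iS1 (B g)) ->
  (resolvent_set D0 0 ->
   (exists Sinv : {linear DmS -> DS},
      [/\ bounded_op Sinv, cancel SmS Sinv & cancel Sinv SmS]) ->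
   resolvent_set S0 0 /\ resolvent_set A0 0)
  /\
  (dense [set f | range (comp_emb iS' iS1) (S f)] ->
   F_plus D0 -> F_plus S0 ->
   (exists Sd : {linear DmS -> DS}, bounded_op Sd /\
      forall h k, graph (gen_inv S0) (h, k) -> iS (Sd (iS' h)) = k) ->
   F_plus A0).
Proof.
move=> S A0 S0 SmS bounded_SmS SmSE B_dom.
have Acont := (bounded_op_linearP _ _ _).1 bounded_A.
have Bcont := (bounded_op_linearP _ _ _).1 bounded_B.
have Ccont := (bounded_op_linearP _ _ _).1 bounded_C.
have Dcont := (bounded_op_linearP _ _ _).1 bounded_D.
have Ddcont := (bounded_op_linearP _ _ _).1 bounded_Dd.
have SmScont := (bounded_op_linearP _ _ _).1 bounded_SmS.
have iScont := @emb_continuous _ _ _ iS; have iS'cont := @emb_continuous _ _ _ iS'.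
have i2'cont := @emb_continuous _ _ _ i2'.
have comp (U V W : hilbertType R) (f : U -> V) (g : V -> W) :
    continuous f -> continuous g -> continuous (fun x => g (f x)).
  move=> fc gc x; apply: (@continuous_comp _ _ _ f g); [exact: fc | exact: gc].
have addc (U V : hilbertType R) (f g : U -> V) :
    continuous f -> continuous g -> continuous (fun x => f x + g x).
  by move=> fc gc x; apply: cvgD; [exact: fc | exact: gc].
have subc (U V : hilbertType R) (f g : U -> V) :
    continuous f -> continuous g -> continuous (fun x => f x - g x).
  by move=> fc gc x; apply: cvgB; [exact: fc | exact: gc].
have compfst (U V W : hilbertType R) (g : U -> W) :
    continuous g -> continuous (fun x : hsum U V => g x.1).
  exact: (comp (hsum U V) U W fst g (@fst_hsum_continuous R U V)).
have compsnd (U V W : hilbertType R) (g : V -> W) :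
    continuous g -> continuous (fun x : hsum U V => g x.2).
  exact: (comp (hsum U V) V W snd g (@snd_hsum_continuous R U V)).
pose T := block A B C D.
have Tcont : continuous T.
  change (continuous (fun x : hsum DS D2 =>
    (A x.1 + B x.2, C x.1 + D x.2) : hsum Dm1 Dm2)).
  apply: hsum_pair_continuous.
    exact: (addc _ _ _ _ (compfst _ _ _ _ Acont) (compsnd _ _ _ _ Bcont)).
  exact: (addc _ _ _ _ (compfst _ _ _ _ Ccont) (compsnd _ _ _ _ Dcont)).
have kerD := ker_extension _ _ _ _ _ closed_D0 Dcont Ddcont ext_D ext_Dd dense_D0.
(* [T2] is [B Dd] on [H2], lifted to [DmS]: on [H2], [Dd] is the generalised inverse of [D0], with
   values in [dom D0]. *)
have [T2 [T2cont T2E]] : exists T2 : {linear H2 -> DmS},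
    continuous T2 /\ forall v, iS1 (T2 v) = B (Dd (i2' v)).
  apply: (continuous_lift _ _ _ iS1 (B \o (Dd \o i2'))).
    exact: (comp _ _ _ _ _ (comp _ _ _ _ _ i2'cont Ddcont) Bcont).
  move=> v; apply: B_dom.
  have [k Dk domk] := gen_inv_total _ closed_D0 v closed_ran_D0.
  by rewrite (ext_Dd _ _ Dk).
(* Block elimination for the right-hand side [(u, v)]: first [f = Sd (u - B Dd v)], then
   [g = Dd (v - C f)]. *)
have regularizer (Sd : {linear DmS -> DS}) : continuous Sd ->
    exists L : {linear hsum H1 H2 -> hsum DS D2}, continuous L /\
    forall w, L w = (Sd (iS' w.1 - T2 w.2),
                     Dd (i2' w.2 - C (Sd (iS' w.1 - T2 w.2)))).
  move=> Sdcont.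
  pose l1 (w : hsum H1 H2) := Sd (iS' w.1 - T2 w.2).
  pose l2 (w : hsum H1 H2) := Dd (i2' w.2 - C (l1 w)).
  have l1lin : linear l1.
    move=> a x y; rewrite /l1 /= -[RHS]linearP; congr (Sd _).
    by rewrite (linearP iS') (linearP T2) scalerBr opprD addrACA.
  have l2lin : linear l2.
    move=> a x y; rewrite /l2 /= -[RHS]linearP; congr (Dd _).
    by rewrite l1lin (linearP C) (linearP i2') scalerBr opprD addrACA.
  have l1cont : continuous l1.
    exact: (comp _ _ _ _ _
      (subc _ _ _ _ (compfst _ _ _ _ iS'cont) (compsnd _ _ _ _ T2cont)) Sdcont).
  have l2cont : continuous l2.
    exact: (comp _ _ _ _ _ (subc _ _ _ _ (compsnd _ _ _ _ i2'cont)
      (comp _ _ _ _ _ l1cont Ccont)) Ddcont).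
  have [L LE] := hsum_pair_linear _ _ _
    (HB.pack l1 (GRing.isLinear.Build _ _ _ _ _ l1lin) : {linear _ -> _})
    (HB.pack l2 (GRing.isLinear.Build _ _ _ _ _ l2lin) : {linear _ -> _}).
  exists L; split=> [|w]; last exact: LE.
  by rewrite (_ : L = (fun w => (l1 w, l2 w)) :> (_ -> _));
    [exact: hsum_pair_continuous | exact/funext].
(* For a solution [(f, g)], substituting the second row into the first gives
   [S f = u - B Dd v - B (g - Dd (D g))]. The element [b] represents the last term in [DmS], and the
   error of [L] involves only [b] and the defects of [Sd] and [Dd]. *)
have defect (Sd : {linear DmS -> DS}) (L : {linear hsum H1 H2 -> hsum DS D2}) :
    (forall w, L w = (Sd (iS' w.1 - T2 w.2),
                     Dd (i2' w.2 - C (Sd (iS' w.1 - T2 w.2))))) ->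
    forall x w, T x = hsum_emb (comp_emb iS' iS1) i2' w ->
    exists2 b, iS1 b = B (- (x.2 - Dd (D x.2))) &
      (x - L w).1 = (x.1 - Sd (SmS x.1)) + Sd b /\
      (x - L w).2 = (x.2 - Dd (D x.2)) + Dd (C (- (x - L w).1)).
  move=> LE [f g] [u v] /= [ABE CDE].
  exists (SmS f - iS' u + T2 v).
    rewrite linearD linearB SmSE T2E -CDE.
    have -> : iS1 (iS' u) = A f + B g by [].
    rewrite /S /schur/= (linearD Dd) (linearD B) (linearN B) (linearB B).
    by rewrite opprB opprD addrACA subrK !addrA subrr add0r addrC.
  rewrite LE/=; split.
    rewrite -[RHS]addrA; congr (_ + _); rewrite -!(linearN Sd) -linearD; congr (Sd _).
    by rewrite opprB !addrA addNr add0r addrC.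
  rewrite -CDE -[RHS]addrA; congr (_ + _).
  rewrite -!(linearN Dd) -linearD; congr (Dd _).
  by rewrite (linearN C) (linearB C) !opprB opprD addrA [RHS]addrC.
split.
  move=> /resolvent_set0P[D0inv [_ D0invE]].
  move=> [Sinv [/bounded_op_linearP Sinvcont SmSK SinvK]].
  (* This lies in the kernel of [D0], which is trivial here. *)
  have P0 g : g - Dd (D g) = 0.
    apply: (@emb_inj _ _ _ i2).
    by have /D0invE := kerD g; rewrite !linear0.
  (* By density of [H2] in [Dm2] it is enough to take [w] in [H2], where [w = D g] with [g] the
     preimage of [w] under [D0]. *)
  have DDd w : D (Dd w) = w.
    move: w; apply: (dense_closed _ _ [set w | D (Dd w) = w] dense_i2').
      exact: closed_fixpoints (comp _ _ _ _ _ Ddcont Dcont).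
    move=> _ [h _ <-] /=; have D0h := (D0invE (D0inv h) h).1 erefl.
    have [|g _ gE] := dom_D0 (D0inv h); first by exists h.
    rewrite -gE in D0h; rewrite -(ext_D _ _ D0h); congr (D _).
    by apply/esym/eqP; rewrite -subr_eq0; apply/eqP; exact: P0.
  have [L [Lcont LE]] := regularizer _ Sinvcont.
  split; apply/resolvent_set0P.
    exists (iS \o (Sinv \o iS')); split.
      exact: (comp _ _ _ _ _ (comp _ _ _ _ _ iS'cont Sinvcont) iScont).
    move=> x z; split=> [<-|[f /= <- Sf]] /=.
      have Sz : S (Sinv (iS' z)) = iS1 (iS' z) by rewrite -SmSE SinvK.
      by exists (Sinv (iS' z)).
    congr (iS _); rewrite -[RHS]SmSK; congr (Sinv _).
    by apply: (@emb_inj _ _ _ iS1); rewrite SmSE.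
  exists (hsum_emb iS i2 \o L); split.
    exact: (comp _ _ _ _ _ Lcont (@emb_continuous _ _ _ (hsum_emb iS i2))).
  move=> x z; split=> [<-|[w /= <- Tw]].
    (* [L] is a right inverse: [D Dd = 1] settles the second row and [S Sinv = 1] the first. *)
    exists (L z) => //=; rewrite LE /hsum_map/block_fun/= DDd.
    congr pair; last by rewrite addrC subrK.
    set l := Sinv _; rewrite (linearB Dd) (linearB B) addrCA -T2E.
    have -> : A l - B (Dd (C l)) = S l by [].
    by rewrite -SmSE SinvK -linearD addrC subrK.
  (* [L] is a left inverse: every term of [defect] vanishes. *)
  congr (hsum_map iS i2 _); apply/esym/eqP; rewrite -subr_eq0; apply/eqP.
  have [b bE [w1 w2]] := defect _ _ LE _ _ Tw.
  have b0 : b = 0.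
    by apply: (@emb_inj _ _ _ iS1); rewrite bE P0 oppr0 !linear0.
  have {}w1 : (w - L z).1 = 0 by rewrite w1 SmSK subrr b0 linear0 addr0.
  have {}w2 : (w - L z).2 = 0 by rewrite w2 P0 w1 oppr0 !linear0 addr0.
  by rewrite [LHS]surjective_pairing w1 w2.
move=> dense_S0 [_ _ fD] [closed_S0 _ fS] [Sd [/bounded_op_linearP Sdcont ext_Sd]].
(* [ker_extension] is applied to [S0] with [DmS], not [Dm1], as the large space, since [Sd] is only
   defined there. *)
have kerS : forall f, ker S0 (iS (f - Sd (SmS f))).
  apply: (ker_extension _ _ _ SmS Sd closed_S0 SmScont Sdcont _ ext_Sd).
    move=> f h [f' /= /emb_inj -> Sf].
    by apply: (@emb_inj _ _ _ iS1); rewrite SmSE.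
  move: dense_S0; congr dense; apply/seteqP; split=> f.
    by move=> [h _ hE]; exists h, f.
  by move=> [h [f' /= /emb_inj -> Sf]]; exists h.
pose N2 := i2 @^-1` ker D0; pose NS := iS @^-1` ker S0.
have fN2 : finite_dim N2.
  apply: finite_dim_preimage fD; first exact: emb_inj.
  by move=> x D0x; apply: dom_D0; exists 0.
have fNS : finite_dim NS.
  apply: finite_dim_preimage fS; first exact: emb_inj.
  by move=> x [f /= <- _]; exists f.
(* [Nb] contains the elements [b] of [defect]; it is finite-dimensional because [B] maps [N2], which
   lies in [dom D0], into [DmS]. The sums [F1] and [F2] then mirror the two formulas of [defect]. *)
pose Nb := iS1 @^-1` (B @` N2).
have fNb : finite_dim Nb.
  apply: finite_dim_preimage; first exact: emb_inj.
    by move=> _ [g N2g <-]; apply: B_dom; exists 0.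
  exact: finite_dim_image.
pose F1 := [set x | exists y z, [/\ NS y, (Sd @` Nb) z & x = y + z]].
have fF1 : finite_dim F1 by apply: finite_dimD => //; exact: finite_dim_image.
pose F2 := [set x | exists y z, [/\ N2 y, ((Dd \o C) @` F1) z & x = y + z]].
have fF2 : finite_dim F2 by apply: finite_dimD => //; exact: finite_dim_image.
have [L [Lcont LE]] := regularizer _ Sdcont.
apply: (F_plus_part _ _ _ _ _ _ L _ Tcont Lcont (finite_dim_hsum _ _ _ _ fF1 fF2)).
move=> x w Tx; have [b bE [x1 x2]] := defect _ _ LE _ _ Tx.
have N2N g : N2 g -> N2 (- g).
  by rewrite -scaleN1r; apply: subspaceZ; exact: finite_dim_subspace.
have F1x : F1 (x - L w).1.
  exists (x.1 - Sd (SmS x.1)), (Sd b); split=> //; first exact: kerS.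
  by exists b => //; exists (- (x.2 - Dd (D x.2))) => //; apply: N2N; exact: kerD.
split=> //=.
exists (x.2 - Dd (D x.2)), (Dd (C (- (x - L w).1))); split=> //; first exact: kerD.
exists (- (x - L w).1) => //.
by rewrite -scaleN1r; apply: subspaceZ => //; exact: finite_dim_subspace.
Qed.
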